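(* Let $G_2 := \bigoplus_{n=1}^{\infty} \mathbb{Z}/2\mathbb{Z}$. For all $\varepsilon>0$, there is a measure preserving action $T$ of $G_2$ on a probability measure space $(X,\mu)$, a (measurable) set $D\subseteq X$ such that $\mu(D)>\frac12-\varepsilon$, and a set $S\subseteq G_2$ such that every translate $S+h$ ($h\in G_2$) of $S$ is a set of topological recurrence, such that $D\cap T^gD=\varnothing$ for all $g\in S$.
   Context: Let $G$ be a countable abelian group. An action $T$ of $G$ on a probability measure space $(X,\mu)$ is measure preserving if $\mu(T^gD)=\mu(D)$ for every measurable $D\subseteq X$ and every $g\in G$. A topological $G$-system is a pair $(X,T)$ where $X$ is a (nonempty) compact metric space and $T$ is an action of $G$ on $X$ by homeomorphisms; it is minimal if for every $x\in X$ the orbit $\{T^gx : g\in G\}$ is dense in $X$. A set $S\subseteq G$ is a set of topological recurrence if for every minimal topological $G$-system $(X,T)$ and every nonempty open $U\subseteq X$, there exists $g\in S$ such that $U\cap T^gU\neq\varnothing$. *)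

(* Defs.v *)
From HB Require Import structures.
From mathcomp Require Import all_boot all_order all_algebra.
From mathcomp Require Import all_classical all_reals all_analysis.

Set Implicit Arguments.
Unset Strict Implicit.
Unset Printing Implicit Defensive.
Import Order.TTheory GRing.Theory Num.Theory.
Local Open Scope classical_set_scope.
Local Open Scope ring_scope.

(* The direct sum of copies of Z/2Z indexed by nat: the subgroup of finitely
   supported functions in the product group nat -> 'Z_2. *)
Definition finsupp2 : {pred nat -> 'Z_2} :=
  [pred x : nat -> 'Z_2 | `[< finite_set [set n | x n != 0] >]].

Fact finsupp2_zmod_closed : zmod_closed finsupp2.
Proof.
split=> [|x y]; rewrite !inE.
  have -> : [set n | (0 : nat -> 'Z_2) n != 0] = set0.
    by apply/seteqP; split=> n //=; rewrite eqxx.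
  exact: finite_set0.
move=> fx fy.
apply: (@sub_finite_set _ _ ([set n | x n != 0] `|` [set n | y n != 0])).
  move=> n /=; case: (eqVneq (x n) 0) => [x0|]; last by left.
  case: (eqVneq (y n) 0) => [y0|]; last by right.
  have -> : (x - y) n = x n - y n by [].
  by rewrite x0 y0 subrr eqxx.
by rewrite finite_setU.
Qed.

HB.instance Definition _ :=
  GRing.isZmodClosed.Build (nat -> 'Z_2) finsupp2 finsupp2_zmod_closed.

Record G2 : Type := MkG2 {
  G2val :> nat -> 'Z_2;
  G2valP : G2val \in finsupp2
}.

HB.instance Definition _ := [isSub for G2val].
HB.instance Definition _ := [Choice of G2 by <:].
HB.instance Definition _ := [SubChoice_isSubZmodule of G2 by <:].

Definition is_action (G : zmodType) (X : Type) (T : G -> X -> X) : Prop :=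
  (forall x, T 0 x = x) /\ (forall g h x, T (g + h) x = T g (T h x)).

(* Since T g has the measurable inverse T (- g), the image of a measurable
   set under T g is again measurable. *)
Definition measure_preserving_action (R : realType) (G : zmodType)
    (d : measure_display) (X : measurableType d) (mu : probability X R)
    (T : G -> X -> X) : Prop :=
  [/\ is_action T,
      forall g, measurable_fun [set: X] (T g)
    & forall (g : G) (D : set X), measurable D -> mu (T g @` D) = mu D].

Definition is_homeomorphism (X : topologicalType) (f : X -> X) : Prop :=
  exists f' : X -> X,
    [/\ cancel f f', cancel f' f, continuous f & continuous f'].

Definition topological_system (R : realType) (G : zmodType)
    (X : metricType R) (T : G -> X -> X) : Prop :=
  [/\ [set: X] !=set0, compact [set: X], is_action T
    & forall g, is_homeomorphism (T g)].

Definition minimal_system (R : realType) (G : zmodType)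
    (X : metricType R) (T : G -> X -> X) : Prop :=
  topological_system T /\ forall x : X, dense (range (fun g : G => T g x)).

(* R only serves as the field of values of the metrics. *)
Definition topological_recurrence (R : realType) (G : zmodType) (S : set G)
    : Prop :=
  forall (X : metricType R) (T : G -> X -> X), minimal_system T ->
    forall U : set X, open U -> U !=set0 ->
      exists2 g : G, S g & U `&` (T g @` U) !=set0.

Definition translate (G : zmodType) (S : set G) (h : G) : set G :=
  [set s + h | s in S].

(* Main.v *)
Require Import Defs.
From HB Require Import structures.
From mathcomp Require Import all_boot all_order all_algebra.
From mathcomp Require Import fingroup perm.
From mathcomp Require Import all_classical all_reals all_analysis.
From mathcomp Require Import zify ring lra.

(* Index countably many blocks of coordinates, the i-th of odd size n_i, by the
   pairs (h, r) with h in G2 and r in nat, so that h lives strictly below its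
   block.  Let S consist of the h + e with e supported in the block of (h, r)
   and having at most l >= r zeros there.

   Every translate of S is a set of topological recurrence because, by a
   Borsuk-Ulam type argument (the parity form of Ky Fan's lemma, on flags of
   sign vectors), any r-colouring of {0,1}^n with r <= n has a monochromatic
   pair at Hamming distance at least n - r.

   For the other half, G2 acts on fair coin sequences u by a tower of skew
   products: the coordinates of a block are translated, and whenever this moves
   the block across its majority threshold the element acting on the lower
   coordinates is corrected by h + delta_0.  If no block of u is nearly
   balanced, h + e in S flips the majority of its block, the correction cancels
   h, and the only effect below is to flip u_0.  So
   D = {u_0 = 0, no block nearly balanced} is disjoint from its shifts by S, and
   taking the n_i large makes the measure of D as close to 1/2 as wanted. *)

Set Implicit Arguments.
Unset Strict Implicit.
Unset Printing Implicit Defensive.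

(** * Ky Fan's lemma and near-antipodal pairs *)

(** The involution pairs indices where [q] is true with indices where it is false, and paired terms
    are equal, so everything cancels modulo 2. *)
Lemma big_addb_involution (I : finType) (P q F : pred I) (h : I -> I) :
  involutive h -> (forall x, P x -> P (h x)) ->
  (forall x, P x -> F (h x) = F x) -> (forall x, P x -> q (h x) = ~~ q x) ->
  \big[addb/false]_(x | P x) F x = false.
Proof.
move=> hK Ph Fh qh; rewrite (bigID q) /= [X in _ (+) X](reindex_inj (inv_inj hK)) /=.
have PhE x : P (h x) = P x by apply/idP/idP => /Ph; rewrite ?hK.
rewrite [X in _ (+) X](eq_big (fun x => P x && q x) F) ?addbb// => x; rewrite PhE.
  by case Px: (P x) => //=; rewrite qh// negbK.
by case/andP=> Px _; exact: Fh.
Qed.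

Fixpoint alternates (b : bool) (s : seq bool) : bool :=
  if s is x :: s' then (x == b) && alternates (~~ b) s' else true.

Lemma alternates_map_negb b s : alternates b (map negb s) = alternates (~~ b) s.
Proof. by elim: s b => //= x s IHs b; rewrite IHs; case: x; case: b. Qed.

(** Door counting modulo 2. An alternating sequence keeps alternating from its own first sign only
    if its last entry is deleted, and from the opposite sign only if its first one is. A
    non-alternating sequence with an alternating face has a single pair of equal neighbours, and
    deleting either of them works. *)
Lemma alternates_faces (T : eqType) (f : T -> bool) (s : seq T) b :
  uniq s -> s != [::] ->
  \big[addb/false]_(x <- s) alternates b [seq f y | y <- s & y != x] =
  alternates b (map f s) (+) alternates (~~ b) (map f s).
Proof.
elim: s b => // x s IHs b /= /andP[xs us] _.
rewrite big_cons eqxx /= (_ : [seq y <- s | y != x] = s); last first.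
  by apply/all_filterP/allP => y ys; apply: contraNneq xs => <-.
have -> : \big[addb/false]_(z <- s)
    alternates b [seq f y | y <- if x != z then x :: [seq y <- s | y != z]
                                 else [seq y <- s | y != z]] =
    (f x == b) && \big[addb/false]_(z <- s)
       alternates (~~ b) [seq f y | y <- s & y != z].
  case: (f x =P b) => [fxb|/eqP/negbTE fxb] /=.
    apply: eq_big_seq => z zs; rewrite ifT /= ?fxb ?eqxx//.
    by apply: contraNneq xs => ->.
  rewrite big_seq big1// => z zs; rewrite ifT /= ?fxb//.
  by apply: contraNneq xs => ->.
have [s0|s0] := eqVneq s [::]; first by rewrite s0 big_nil /=; case: (f x); case: b.
rewrite IHs// negbK addbC.
by case: (f x); case: b; rewrite /= ?addbF ?addFb // -addbA addbb addbF.
Qed.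

Section KeySortedSigns.
Variables (T : eqType) (key : T -> nat) (sg : T -> bool).

(** With [key] as absolute value and [sg] as sign of a label, this is Fan's condition: by increasing
    absolute value, the signs alternate from [b] on. *)
Definition key_alternates b (l : seq T) : bool :=
  alternates b (map sg (sort (relpre key leq) l)).

Lemma key_alternates_faces (l : seq T) b : uniq l -> l != [::] ->
  \big[addb/false]_(x <- l) key_alternates b [seq y <- l | y != x] =
  key_alternates b l (+) key_alternates (~~ b) l.
Proof.
have lT : total (relpre key leq) by move=> x y; exact: leq_total.
have lt : transitive (relpre key leq) by move=> x y z; exact: leq_trans.
move=> ul l0; rewrite /key_alternates -alternates_faces ?sort_uniq//; last first.
  by rewrite -size_eq0 size_sort size_eq0.
rewrite (perm_big (sort (relpre key leq) l)) /=; last by rewrite perm_sym perm_sort.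
by apply: eq_bigr => x _; rewrite filter_sort.
Qed.

Lemma key_alternates_antipode (f : T -> T) (l : seq T) b :
  {in l, forall x, key (f x) = key x /\ sg (f x) = ~~ sg x} ->
  key_alternates b (map f l) = key_alternates (~~ b) l.
Proof.
(* The sorted signs depend only on the pairs (key, sign), and negating signs commutes with sorting
   by key. *)
move=> fl; pose ks x := (key x, sg x); pose neg2 (u : nat * bool) := (u.1, ~~ u.2).
have E l' : map sg (sort (relpre key leq) l') = map snd (sort (relpre fst leq) (map ks l')).
  by rewrite sort_map -map_comp.
rewrite /key_alternates !E -alternates_map_negb.
have -> : map ks (map f l) = map neg2 (map ks l).
  by rewrite -!map_comp; apply/eq_in_map => x /fl[kx sx]; rewrite /= /ks kx sx.
by rewrite sort_map -!map_comp.
Qed.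

(** After sorting, a repeated key occurs at two neighbours, to which alternation gives opposite
    signs, against the hypothesis. *)
Lemma key_alternates_uniq (l : seq T) b : key_alternates b l ->
  {in l &, forall x y, key x = key y -> sg x = sg y} -> uniq (map key l).
Proof.
move=> al kl; rewrite -(perm_uniq (perm_map key (permEl (perm_sort (relpre key leq) l)))).
have : {in sort (relpre key leq) l &, forall x y, key x = key y -> sg x = sg y}.
  by move=> x y; rewrite !mem_sort; exact: kl.
have : sorted (relpre key leq) (sort (relpre key leq) l).
  by apply: sort_sorted => x y; exact: leq_total.
move: al; rewrite /key_alternates; case: (sort _ _) => [//|x s].
move=> al pl sl; apply: (sorted_uniq ltn_trans ltnn); rewrite /=.
elim: s b x al pl sl => //= y s IHs b x /and3P[/eqP sx /eqP sy al] /andP[xy pl] sl.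
rewrite ltn_neqAle xy andbT; apply/andP; split.
  by apply/eqP => /sl; rewrite !inE !eqxx ?orbT /= sx sy => /(_ isT isT); case: (b).
apply: (IHs (~~ b)) => //=; first by rewrite sy eqxx.
by move=> u v us vs; apply: sl; rewrite inE ?us ?vs orbT.
Qed.
End KeySortedSigns.

(** * Ky Fan's lemma on flags of sign vectors *)

Section FanLemma.
Variable n : nat.
Implicit Types (p : 'S_n) (s : {ffun 'I_n -> bool}) (d : nat).
Local Notation V := {ffun 'I_n -> option bool}.

(** [None] encodes 0. The nonzero sign vectors are the vertices of the barycentric subdivision of
    the boundary of the cross-polytope, and the full flags are its facets. *)
Definition antipode (X : V) : V := [ffun c => omap negb (X c)].

(** [p] lists the coordinates in the order in which they become nonzero; the bound is inclusive, so
    vector number [i] has [i.+1] nonzero entries. *)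
Definition prefix_vector p s (i : nat) : V :=
  [ffun c => if (p^-1)%g c <= i then Some (s c) else None].

Definition flag p s d : seq V := [seq prefix_vector p s i | i <- iota 0 d].

Lemma prefix_vector_inj p s (i j : nat) : i < n -> j < n ->
  prefix_vector p s i = prefix_vector p s j -> i = j.
Proof.
wlog ij : i j / i <= j.
  by move=> H; case/orP: (leq_total i j) => ij ? ? e; [|symmetry]; apply: H.
move=> _ jn /ffunP/(_ (p (Ordinal jn))); rewrite !ffunE permK /= leqnn.
by case: leqP => // ji _; apply/eqP; rewrite eqn_leq ij.
Qed.

Lemma flag_uniq p s d : d <= n -> uniq (flag p s d).
Proof.
move=> dn; rewrite map_inj_in_uniq ?iota_uniq// => i j.
by rewrite !mem_iota /= !add0n => id jd; apply: prefix_vector_inj; exact: leq_trans dn.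
Qed.

Lemma flag_face p s d i : d <= n -> i < d ->
  [seq Y <- flag p s d | Y != prefix_vector p s i] =
  [seq prefix_vector p s j | j <- iota 0 d & j != i].
Proof.
move=> dn id; rewrite /flag filter_map; congr map.
apply: eq_in_filter => j; rewrite mem_iota /= add0n => jd; congr negb.
apply/eqP/eqP => [|->//]; apply: prefix_vector_inj; exact: leq_trans dn.
Qed.

Let low d : {set 'I_n} := [set c : 'I_n | c < d].
Let tail_true d s := [forall c : 'I_n, (d <= c) ==> s c].

Variables (key : V -> nat) (sg : V -> bool).
Hypothesis key_sg : forall X : V, (exists c, X c) ->
  key (antipode X) = key X /\ sg (antipode X) = ~~ sg X.

(** Counts modulo 2 the alternating full flags of the cross-polytope on the coordinates below [d];
    [p] and [s] are normalised on the other coordinates, so that each flag counts once. *)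
Let parity d := \big[addb/false]_(p | perm_on (low d) p)
  \big[addb/false]_(s | tail_true d s) key_alternates key sg true (flag p s d).

(** A face missing a vector below the top one lies in two flags of the hemisphere, which differ by
    exchanging the coordinates listed at positions [i] and [i.+1]. *)
Let swap_sum d i : d < n -> i < d ->
  \big[addb/false]_(p | perm_on (low d.+1) p)
    \big[addb/false]_(s | tail_true d s) key_alternates key sg true
      [seq prefix_vector p s j | j <- iota 0 d.+1 & j != i] = false.
Proof.
move=> dn id.
have in_ : i < n by exact: ltn_trans dn.
have iSn : i.+1 < n by exact: leq_ltn_trans dn.
pose o1 := Ordinal in_; pose o2 := Ordinal iSn; pose t : 'S_n := tperm o1 o2.
apply: (@big_addb_involution _ _ (fun p => p o1 < p o2) _ (fun p => (t * p)%g)).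
- by move=> p; rewrite mulgA tperm2 mul1g.
- move=> p pd; apply: perm_onM => //; apply/fintype.subsetP => x.
  rewrite !inE; apply: contraR => xd; rewrite tpermD//.
    by apply: contraNneq xd => <- /=; rewrite ltnS ltnW.
  by apply: contraNneq xd => <- /=; rewrite ltnS.
- move=> p _; apply: eq_bigr => s _; congr key_alternates.
  apply/eq_in_map => j; rewrite mem_filter => /andP[ji _].
  apply/ffunP => c; rewrite !ffunE invMg tpermV permM.
  congr (if _ then _ else _); case: tpermP => [->|->|//] /=.
    by rewrite [RHS]leq_eqVlt eq_sym (negbTE ji).
  by rewrite [LHS]leq_eqVlt eq_sym (negbTE ji).
- move=> p _; rewrite !permM tpermL tpermR -leqNgt ltn_neqAle.
  rewrite (_ : (_ != _) = true)//; apply/negP => /eqP/val_inj/perm_inj/(congr1 val) /eqP.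
  by rewrite /= eqn_leq ltnn.
Qed.

(** Dropping the top vector forgets the sign of the coordinate listed last. If that coordinate is
    not [d], its sign is free and the terms cancel in pairs; if it is [d], the face is a full flag
    of the equator. *)
Let top_sum d : d < n ->
  \big[addb/false]_(p | perm_on (low d.+1) p)
    \big[addb/false]_(s | tail_true d s) key_alternates key sg true (flag p s d)
  = parity d.
Proof.
move=> dn; pose o := Ordinal dn.
rewrite (bigID (fun p => p o == o)) /= [X in _ (+) X]big1 ?addbF.
  apply: eq_bigl => p; apply/andP/idP => [[pd /eqP po]|pd].
    apply/fintype.subsetP => c; rewrite !inE => pc; move: (fintype.subsetP pd c).
    rewrite !inE => /(_ pc); rewrite ltnS leq_eqVlt => /orP[/eqP cd|//].
    by move: pc; rewrite (_ : c = o) ?po ?eqxx//; apply: val_inj.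
  split; first by apply: fintype.subset_trans pd _; apply/fintype.subsetP => c; rewrite !inE; exact: ltnW.
  by apply/eqP; apply: out_perm pd _; rewrite inE ltnn.
move=> p /andP[pd po].
pose h s : {ffun 'I_n -> bool} := [ffun c => (c == p o) (+) s c].
apply: (@big_addb_involution _ _ (fun s => s (p o)) _ h).
- by move=> s; apply/ffunP => c; rewrite !ffunE addbA addbb.
- move=> s /forallP sd; apply/forallP => c; apply/implyP => dc.
  rewrite ffunE (implyP (sd c))// addbT; apply: contraNneq po => cpo.
  have : p o \in low d.+1 by rewrite perm_closed// inE /= ltnS.
  rewrite inE -cpo => cd; apply/eqP/val_inj => /=; apply/eqP.
  by rewrite eqn_leq dc andbT.
- move=> s _; congr key_alternates; apply/eq_in_map => j; rewrite mem_iota => /andP[_ jd].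
  apply/ffunP => c; rewrite !ffunE; case: (c =P p o) => // ->.
  by rewrite permK /= leqNgt jd.
- by move=> s _; rewrite ffunE eqxx addTb.
Qed.

(** The antipode carries flags with negative coordinate [d] to the positive hemisphere, where they
    count as alternating from [false]. By door counting the total is the number of alternating faces
    of the hemisphere; inner faces cancel by [swap_sum], and the equator contributes [parity d]. *)
Let parityS d : d < n -> parity d.+1 = parity d.
Proof.
move=> dn; pose o := Ordinal dn.
transitivity (\big[addb/false]_(p | perm_on (low d.+1) p)
   \big[addb/false]_(s | tail_true d s)
      \big[addb/false]_(i <- iota 0 d.+1) key_alternates key sg true
      [seq prefix_vector p s j | j <- iota 0 d.+1 & j != i]).
  apply: eq_bigr => p pd; rewrite (bigID (fun s => s o)) /=.
  rewrite (eq_bigl (tail_true d)); last first.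
    move=> s; apply/andP/forallP => [[/forallP sd so] c|sd].
      apply/implyP; rewrite leq_eqVlt => /orP[/eqP dc|dc]; last exact: (implyP (sd c)).
      by rewrite (_ : c = o)//; apply: val_inj.
    split; last exact: (implyP (sd o)).
    by apply/forallP => c; apply/implyP => /ltnW; exact: (implyP (sd c)).
  pose h s : {ffun 'I_n -> bool} := [ffun c : 'I_n => (c <= d) (+) s c].
  have hK : involutive h by move=> s; apply/ffunP => c; rewrite !ffunE addbA addbb.
  rewrite [X in _ (+) X](reindex_inj (inv_inj hK)) /=.
  rewrite [X in _ (+) X](eq_bigl (tail_true d)); last first.
    move=> s; rewrite ffunE leqnn addTb negbK; apply/andP/forallP => [[/forallP sd so] c|sd].
      apply/implyP; rewrite leq_eqVlt => /orP[/eqP dc|dc].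
        by rewrite (_ : c = o)//; apply: val_inj.
      by move/implyP: (sd c) => /(_ dc); rewrite ffunE leqNgt dc.
    split; last exact: (implyP (sd o)).
    apply/forallP => c; apply/implyP => dc; rewrite ffunE [(c <= d)%N]leqNgt dc.
    exact: (implyP (sd c) (ltnW dc)).
  rewrite -big_split; apply: eq_bigr => s _ /=.
  have -> : flag p (h s) d.+1 = map antipode (flag p s d.+1).
    rewrite /flag -map_comp; apply/eq_in_map => j; rewrite mem_iota add0n => /andP[_ jd].
    apply/ffunP => c; rewrite !ffunE; case: leqP => //= pj; congr Some.
    have : p ((p^-1)%g c) \in low d.+1.
      by rewrite perm_closed// inE; exact: leq_ltn_trans jd.
    by rewrite permKV inE ltnS => ->.
  rewrite key_alternates_antipode; last first.
    move=> X /mapP[j]; rewrite mem_iota => _ ->; apply: key_sg.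
    by exists (p (Ordinal (leq_ltn_trans (leq0n d) dn))); rewrite ffunE permK.
  rewrite -key_alternates_faces ?flag_uniq//.
  rewrite [in LHS]/flag big_map; apply: eq_big_seq => i; rewrite mem_iota add0n => /andP[_ id].
  by rewrite -[map _ _]/(flag p s d.+1) flag_face.
under eq_bigr do rewrite exchange_big.
rewrite exchange_big.
have iE : iota 0 d.+1 = rcons (iota 0 d) d by rewrite -addn1 iotaD cats1.
rewrite [X in bigop _ X _](_ : _ = rcons (iota 0 d) d)// big_rcons big_seq big1 ?addbF.
  rewrite -top_sum//; apply: eq_bigr => p _; apply: eq_bigr => s _; congr key_alternates.
  rewrite iE filter_rcons eqxx; congr map.
  by apply/all_filterP/allP => j; rewrite mem_iota add0n => /andP[_ jd]; rewrite ltn_eqF.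
by move=> i; rewrite mem_iota add0n => /andP[_ id]; exact: swap_sum.
Qed.

(** The number of alternating full flags is odd: [parity 0] counts just the empty flag, and the
    parity is the same in each dimension. *)
Lemma fan_alternating_flag : exists p s, key_alternates key sg true (flag p s n).
Proof.
have par d : d <= n -> parity d = true.
  elim: d => [_|d IHd dn]; last by rewrite parityS// IHd// ltnW.
  rewrite /parity (big_pred1 1%g); last first.
    move=> p; apply/idP/eqP => [p0|->]; last exact: perm_on1.
    by apply/permP => c; rewrite perm1 (out_perm p0)// inE.
  rewrite (big_pred1 [ffun=> true])// => s; apply/forallP/eqP => [s0|->] /=.
    by apply/ffunP => c; rewrite ffunE; exact: (implyP (s0 c)).
  by move=> c; rewrite ffunE.
have [/existsP[p /existsP[s ps]]|/existsPn H] := boolP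
    [exists p, exists s, key_alternates key sg true (flag p s n)]; first by exists p, s.
have := par n (leqnn n); rewrite /parity big1// => p _; rewrite big1// => s _.
by apply/negbTE; have /existsPn := H p; exact.
Qed.
End FanLemma.

(** * Monochromatic near-antipodal pairs in the cube *)

Section NearAntipodalPair.
Variables (n r : nat) (c : {ffun 'I_n -> bool} -> nat).
Hypotheses (rn : r <= n) (cr : forall x, c x < r).
Local Notation V := {ffun 'I_n -> option bool}.
Implicit Types X Y : V.

Let supp X : {set 'I_n} := [set i | X i].
Let fill X : {ffun 'I_n -> bool} := [ffun i => odflt true (X i)].
Let lowv X := #|supp X| + r < n.
(** Short vectors are told apart by support size, with keys below [n - r]; long ones get keys from
    [n - r] on. Both completions put [true] at the zeros, so they differ exactly on the support. *)
Let key X := if lowv X then #|supp X| else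
  n - r + minn (c (fill X)) (c (fill (antipode X))).
Let sg X := if lowv X then (if [pick i | X i] is Some i then X i == Some true else true)
  else c (fill X) < c (fill (antipode X)).

Let suppN X : supp (antipode X) = supp X.
Proof. by apply/setP => i; rewrite !inE ffunE; case: (X i). Qed.

Let antipodeK : involutive (@antipode n).
Proof. by move=> X; apply/ffunP => i; rewrite !ffunE; case: (X i) => [[]|]. Qed.

(* If some colour class contained no near-antipodal pair, the smaller of the
   colours of the two completions of a sign vector with few zeros, signed by
   which completion attains it, would label the flags antipodally with too few
   keys for the alternating flag to exist. *)
Lemma near_antipodal_pair : exists x y : {ffun 'I_n -> bool},
  c x = c y /\ n <= #|[set i | x i != y i]| + r.
Proof.
case: (boolP [exists x, exists y, (c x == c y) &&
    (n <= #|[set i | x i != y i]| + r)]) => [/existsP[x /existsP[y /andP[/eqP xy d]]]|].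
  by exists x, y.
move=> /existsPn H; exfalso.
have {}H x y : c x = c y -> #|[set i | x i != y i]| + r < n.
  by move=> xy; have /existsPn/(_ y) := H x; rewrite xy eqxx /= -ltnNge.
(* The two completions differ on the whole support of [X], which has at least [n - r] elements, so
   [H] forbids equal colours. *)
have sub X Y : (forall i, X i -> Y i = X i) -> ~~ lowv X ->
    c (fill X) <> c (fill (antipode Y)).
  move=> XY Xl /H; apply/negP; apply: contra Xl; apply: leq_ltn_trans.
  rewrite leq_add2r; apply/subset_leq_card/fintype.subsetP => i.
  rewrite !inE !ffunE => Xi; rewrite XY//; by case: (X i) Xi => // -[].
have lowN X : lowv (antipode X) = lowv X by rewrite /lowv suppN.
have neq X : ~~ lowv X -> c (fill X) <> c (fill (antipode X)) by apply: sub.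
have key_sg X : (exists i, X i) ->
    key (antipode X) = key X /\ sg (antipode X) = ~~ sg X.
  move=> [i Xi]; rewrite /key /sg lowN suppN antipodeK minnC; split => //.
  case: ifPn => [_|/neq neX].
    rewrite (@eq_pick _ (fun i => antipode X i) (fun i => X i)); last first.
      by move=> j /=; rewrite ffunE; case: (X j).
    case: pickP => [j|/(_ i)]; last by rewrite Xi.
    by rewrite ffunE; case: (X j) => [[]|].
  by rewrite -leqNgt [RHS]leq_eqVlt eq_sym; move/eqP/negbTE: neX => ->.
have [p [s /key_alternates_uniq U]] := fan_alternating_flag key_sg.
have {U} : uniq (map key (flag p s n)).
  apply: U => X Y Xf Yf.
  (* Two long vectors of a flag with the same minimal colour attained on opposite sides would
     violate [sub], so equal keys carry equal signs. *)
  have sgeq X' Y' : (forall i, X' i -> Y' i = X' i) -> key X' = key Y' -> sg X' = sg Y'.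
    move=> XY; rewrite /key /sg.
    have supXY : supp X' \subset supp Y'.
      by apply/fintype.subsetP => i; rewrite !inE => Xi; rewrite XY.
    case: ifPn => X'l; case: ifPn => Y'l.
    - move=> e; have {}e : supp X' = supp Y'.
        by apply/eqP; rewrite eqEcard supXY e leqnn.
      rewrite (_ : X' = Y')//; apply/ffunP => i.
      have [Xi|/negbTE Xi] := boolP (X' i : bool); first by rewrite XY.
      have := Xi; move/setP/(_ i): e; rewrite !inE => ->.
      by case: (X' i) Xi => //; case: (Y' i).
    - by move=> e; move: X'l; rewrite /lowv e addnAC subnK// ltnNge leq_addr.
    - by move=> e; move: Y'l; rewrite /lowv -e addnAC subnK// ltnNge leq_addr.
    - move/eqP; rewrite eqn_add2l => /eqP.
      have := sub _ _ XY X'l.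
      have : c (fill (antipode X')) <> c (fill Y').
        have := sub (antipode X') (antipode Y'); rewrite antipodeK lowN; apply => //.
        by move=> i; rewrite !ffunE => Xi; rewrite XY//; move: Xi; case: (X' i).
      by rewrite /minn; case: ltnP => _; case: ltnP => _ // *; congruence.
  move: Xf Yf => /mapP[i _ ->] /mapP[j _ ->].
  have pre i' j' : i' <= j' -> forall k, prefix_vector p s i' k ->
      prefix_vector p s j' k = prefix_vector p s i' k.
    move=> ij k; rewrite !ffunE; case: leqP => // ki.
    by rewrite (leq_trans ki ij).
  case/orP: (leq_total i j) => ij; first by apply: sgeq; exact: pre.
  by move=> e; symmetry; move: (esym e); apply: sgeq; exact: pre.
move=> U; have r0 : 0 < r by exact: leq_ltn_trans (leq0n _) (cr [ffun=> true]).
(* The two colours of a long vector are distinct and below [r], so the smaller is below [r - 1].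
   Hence all keys are below [n.-1], too few for the [n] distinct keys of the flag. *)
have : {subset map key (flag p s n) <= iota 0 n.-1}.
  move=> k /mapP[X _ ->]; rewrite mem_iota /= add0n /key.
  have n0 : 0 < n by exact: leq_trans rn.
  rewrite -ltnS prednK//; case: ifPn => [|/neq neX].
    by apply: leq_ltn_trans; rewrite -addn1 leq_add2l.
  have cX := cr (fill X); have cY := cr (fill (antipode X)).
  rewrite -addnS -[n in _ <= n](subnK rn) -addnS leq_add2l.
  move: neX; rewrite /minn.
  by case: (ltngtP (c (fill X)) (c (fill (antipode X)))) => // h _; exact: leq_ltn_trans h _.
move/(uniq_leq_size U); rewrite size_map size_map !size_iota.
by case: n rn r0 => [|m]; [case: r|rewrite ltnn].
Qed.
End NearAntipodalPair.

Import Order.TTheory GRing.Theory Num.Theory.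
Local Open Scope classical_set_scope.
Local Open Scope ring_scope.

(** * The fair coin-tossing measure *)

Definition bits := nat -> 'Z_2.
HB.instance Definition _ := GRing.Zmodule.on bits.
HB.instance Definition _ := isPointed.Build bits 0.
Implicit Types (u v w z : bits) (A : set bits).

Lemma Z2P (x : 'Z_2) : x = (x != 0)%:R.
Proof. by case: x => [[|[|]]] // ?; apply: val_inj. Qed.

Lemma addZ2K (x : 'Z_2) : x + x = 0.
Proof. by rewrite (Z2P x); case: (x != 0); apply: val_inj. Qed.

Lemma addbits u : u + u = 0.
Proof. by apply/funext => c; rewrite -[RHS](addZ2K (u c)). Qed.

Lemma addbitsE u z c : (u + z) c = u c + z c. Proof. by []. Qed.

(** Membership depends on the first [m] coordinates only; stated through addition, this combines
    directly with maps commuting with such additions. *)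
Definition cylindrical A := exists m, forall u z,
  (forall c, (c < m)%N -> z c = 0) -> A u -> A (u + z).

Definition cylinder w m : set bits := [set u | forall c, (c < m)%N -> u c = w c].

Definition pad m (w : {ffun 'I_m -> 'Z_2}) : bits :=
  fun c => if insub c is Some i then w i else 0.

Lemma padE m (w : {ffun 'I_m -> 'Z_2}) (i : 'I_m) : pad w i = w i.
Proof. by rewrite /pad valK. Qed.

Definition head_bits m u : {ffun 'I_m -> 'Z_2} := [ffun i : 'I_m => u i].

Lemma head_bitsK m u : cylinder u m (pad (head_bits m u)).
Proof. by move=> c cm; rewrite -[c]/(val (Ordinal cm)) padE ffunE. Qed.

Lemma pad_head_bits m (w : {ffun 'I_m -> 'Z_2}) u : cylinder (pad w) m u -> w = head_bits m u.
Proof. by move=> wu; apply/ffunP => i; rewrite ffunE wu// padE. Qed.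

Definition coin_space := g_sigma_algebraType cylindrical.
HB.instance Definition _ := Measurable.on coin_space.

Lemma cylindrical_measurable A : cylindrical A -> measurable (A : set coin_space).
Proof. exact: sub_sigma_algebra. Qed.

Lemma cylindrical_setI : setI_closed cylindrical.
Proof.
move=> A B [m Am] [n Bn]; exists (maxn m n) => u z zmn [Au Bu]; split.
  by apply: Am => // c cm; apply: zmn; rewrite leq_max cm.
by apply: Bn => // c cn; apply: zmn; rewrite leq_max cn orbT.
Qed.

Lemma cylindrical_setT : cylindrical setT. Proof. by exists 0%N. Qed.

Lemma cylinder_cylindrical w m : cylindrical (cylinder w m).
Proof. by exists m => u z z0 uw c cm; rewrite addbitsE z0// addr0 uw. Qed.

Lemma cylindrical_decomposition A m :
  (forall u z, (forall c, (c < m)%N -> z c = 0) -> A u -> A (u + z)) ->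
  A = \bigcup_(w in [set w : {ffun 'I_m -> 'Z_2} | A (pad w)]) cylinder (pad w) m.
Proof.
move=> Am; have Acyl u w : cylinder w m u -> A w -> A u.
  move=> uw Aw; rewrite -[u](subrK w) addrC; apply: Am => // c cm.
  by rewrite addbitsE uw//; exact: subrr (w c).
apply/seteqP; split=> [u Au|u [w /= Aw uw]]; last exact: Acyl Aw.
have tu := head_bitsK (m := m) u; exists (head_bits m u); first exact: Acyl Au.
by move=> c cm; rewrite tu.
Qed.

(** * Coin tossing as the law of the binary digits of a uniform point *)

Section BinaryDigits.
Variable R : realType.

Definition unit_lebesgue := mrestr (@lebesgue_measure R) (measurable_itv `[0%R, 1%R[).
HB.instance Definition _ := Measure.on unit_lebesgue.

Let unit_lebesgueT : unit_lebesgue setT = 1%E.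
Proof.
by rewrite /unit_lebesgue /mrestr setTI lebesgue_measure_itv/= lte_fin ltr01 oppr0 adde0.
Qed.
HB.instance Definition _ := Measure_isProbability.Build _ _ _ unit_lebesgue unit_lebesgueT.

(** The cast into ['Z_2] reduces the integer part modulo 2, which leaves the digit number [c.+1]
    after the point. *)
Definition binary_digits (t : measurableTypeR R) : coin_space :=
  fun c => (Num.truncn (t * 2 ^+ c.+1))%:R.

Let truncn_measurable (x : R) n : 0 < x ->
  measurable [set t : R | Num.truncn (t * x) = n].
Proof.
move=> x0; case: n => [|n].
  rewrite (_ : [set _ | _] = [set` `]-oo, x^-1[%R]); first exact: measurable_itv.
  apply/seteqP; split=> t /=; rewrite in_itv/= -[x^-1]mul1r ltr_pdivlMr//.
    by move/eqP; rewrite -leqn0 truncn_le_nat.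
  by move=> h; apply/eqP; rewrite -leqn0 truncn_le_nat.
rewrite (_ : [set _ | _] = [set` `[n.+1%:R / x, n.+2%:R / x[%R]); first exact: measurable_itv.
apply/seteqP; split=> t /=; rewrite in_itv/= ler_pdivrMr// ltr_pdivlMr//.
  move=> tn; rewrite -tn truncnS_gt andbT truncn_le ltW//.
  by apply: lt_le_trans ltr01 _; rewrite -truncn_gt0 tn.
exact: truncn_def.
Qed.

Lemma binary_digits_cylinder_measurable w m :
  measurable (binary_digits @^-1` cylinder w m).
Proof.
elim: m => [|m IHm].
  by rewrite (_ : _ @^-1` _ = setT)//; apply/seteqP; split.
have -> : binary_digits @^-1` cylinder w m.+1 =
    binary_digits @^-1` cylinder w m `&`
    \bigcup_n (if n%:R == w m then [set t : R | Num.truncn (t * 2 ^+ m.+1) = n] else set0).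
  apply/seteqP; split=> [t tw|t [tw [n _]]].
    split; first by move=> c cm; apply: tw; rewrite ltnW.
    exists (Num.truncn (t * 2 ^+ m.+1)) => //.
    by rewrite ifT//; apply/eqP; exact: (tw m (ltnSn m)).
  case: eqP => // nw /= tn c; rewrite ltnS leq_eqVlt => /orP[/eqP ->|]; last exact: tw.
  by rewrite /binary_digits tn.
apply: measurableI => //; apply: bigcupT_measurable => n.
by case: ifP => // _; apply: truncn_measurable; rewrite exprn_gt0.
Qed.

Let binary_digits_measurable : measurable_fun setT binary_digits.
Proof.
apply: measurability => // _ [A [m Am] <-]; rewrite setTI (cylindrical_decomposition Am).
rewrite preimage_bigcup; apply: fin_bigcup_measurable => // w _.
exact: binary_digits_cylinder_measurable.
Qed.
HB.instance Definition _ := isMeasurableFun.Build _ _ _ _ binary_digits binary_digits_measurable.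

(** The integer with binary expansion [w 0 ... w (m - 1)], most significant digit first; it numbers
    the dyadic interval that corresponds to the cylinder. *)
Let index := fix index w m :=
  if m is m'.+1 then (2 * index w m' + w m')%N else 0%N.

Let index_lt w m : (index w m < 2 ^ m)%N.
Proof.
elim: m => //= m IHm; rewrite expnS.
have wm : (w m < 2)%N by [].
lia.
Qed.

Let truncn_half (y : R) : 0 <= y -> (Num.truncn (y * 2) %/ 2)%N = Num.truncn y.
Proof.
move=> y0; apply/esym/truncn_def.
have : 0 <= y * 2 by rewrite mulr_ge0.
move/truncn_itv; set k := Num.truncn _ => /andP[k1 k2].
have kE : (k%:R : R) = (k %/ 2)%:R * 2 + (k %% 2)%:R.
  by rewrite {1}(divn_eq k 2) natrD natrM.
have r0 : 0 <= ((k %% 2)%:R : R) by rewrite ler0n.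
have r1 : ((k %% 2)%:R : R) <= 1 by rewrite (ler_nat _ _ 1) -ltnS ltn_pmod.
by move: k1 k2; rewrite -!natr1 kE => k1 k2; apply/andP; split; lra.
Qed.

Let cylinder_index w m (t : R) : 0 <= t < 1 ->
  cylinder w m (binary_digits t) <-> Num.truncn (t * 2 ^+ m) = index w m.
Proof.
move=> /andP[t0 t1]; elim: m => [|m IHm] /=.
  split=> // _; apply/eqP; rewrite expr0 mulr1 -leqn0 truncn_le_nat.
  exact: t1.
have -> : cylinder w m.+1 (binary_digits t) <->
    cylinder w m (binary_digits t) /\ binary_digits t m = w m.
  split=> [tw|[tw tm] c]; first by split=> [c cm|]; apply: tw; rewrite // ltnW.
  by rewrite ltnS leq_eqVlt => /orP[/eqP ->|]; [|exact: tw].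
rewrite IHm; have h := truncn_half (y := t * 2 ^+ m).
rewrite /binary_digits exprSr mulrA; set N := Num.truncn (_ * 2) in h *.
rewrite -h ?mulr_ge0 ?exprn_ge0//; have wm : (w m < 2)%N by [].
split=> [[<- <-]|Nw].
  by rewrite val_Zp_nat// mulnC -divn_eq.
split; first lia.
by apply: val_inj; rewrite /= val_Zp_nat//; lia.
Qed.

Definition coin_tossing : probability coin_space R :=
  @distribution _ _ (measurableTypeR R) coin_space R unit_lebesgue binary_digits.

Lemma coin_tossing_cylinder w m : coin_tossing (cylinder w m) = (2^-1 ^+ m)%:E.
Proof.
rewrite /coin_tossing /= /distribution /pushforward /unit_lebesgue /mrestr.
have K := index_lt w m; have p0 : 0 < (2 ^+ m : R) by rewrite exprn_gt0.
rewrite (_ : _ `&` _ = [set` `[(index w m)%:R / 2 ^+ m, (index w m).+1%:R / 2 ^+ m[%R]).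
  rewrite lebesgue_measure_itv/= lte_fin ltr_pM2r ?invr_gt0// ltr_nat ltnSn.
  by rewrite -EFinB -mulrBl -natrB// subSnn mul1r exprVn.
apply/seteqP; split=> t /=; rewrite !in_itv/= ler_pdivrMr// ltr_pdivlMr//.
  move=> [tw t01]; have /andP[t0 _] := t01; move/(cylinder_index _ _ t01): tw => <-.
  by rewrite truncnS_gt truncn_le andbT mulr_ge0// ltW.
move=> h; have t01 : 0 <= t < 1.
  have /andP[h1 h2] := h; apply/andP; split.
    by rewrite -(pmulr_lge0 _ p0); apply: le_trans h1; rewrite ler0n.
  rewrite -(ltr_pM2r p0) mul1r; apply: lt_le_trans h2 _.
  by rewrite -natrX ler_nat.
by split=> //; apply/cylinder_index => //; exact: truncn_def.
Qed.
End BinaryDigits.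

Section Invariance.
Variable R : realType.
Local Notation mu := (@coin_tossing R).

Lemma coin_tossing_cylindrical A m :
  (forall u z, (forall c, (c < m)%N -> z c = 0) -> A u -> A (u + z)) ->
  mu A = (\sum_(w : {ffun 'I_m -> 'Z_2} | `[< A (pad w) >]) (2^-1 ^+ m)%:E)%E.
Proof.
move=> Am; rewrite [in LHS](cylindrical_decomposition Am) measure_fin_bigcup//.
- rewrite (eq_fsbigr (fun=> (2^-1 ^+ m)%:E)) => [|w _]; last exact: coin_tossing_cylinder.
  rewrite -[RHS]big_enum [RHS]fsbig_seq ?enum_uniq//.
  congr (\sum_(_ \in _) _)%E; apply/seteqP; split=> w /=.
    by move=> Aw; rewrite mem_enum; apply/asboolP.
  by rewrite mem_enum => /asboolP.
- exact: finite_finset.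
- by move=> w w' _ _ [u [/pad_head_bits -> /pad_head_bits ->]].
- by move=> w _; apply: cylindrical_measurable; exact: cylinder_cylindrical.
Qed.

Variables (f : bits -> bits) (M : nat).
Hypotheses (fK : involutive f)
  (fM : forall u z, (forall c, (c < M)%N -> z c = 0) -> f (u + z) = f u + z).

Lemma tail_equivariant_measurable :
  measurable_fun setT (f : coin_space -> coin_space).
Proof.
apply: measurability => // _ [A [m Am] <-]; rewrite setTI.
apply: cylindrical_measurable; exists (maxn M m) => u z zm Au; rewrite /= fM.
  by apply: Am => // c cm; apply: zm; rewrite leq_max cm orbT.
by move=> c cM; apply: zm; rewrite leq_max cM.
Qed.

(** For large [n], [f] permutes the cylinders of length [n], all of equal mass, so it preserves the
    measure of cylindrical sets; these form a generating pi-system. *)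
Lemma tail_equivariant_preserving A : measurable (A : set coin_space) ->
  mu (f @` A) = mu A.
Proof.
have -> : f @` A = f @^-1` A.
  by apply/seteqP; split=> [_ [u Au <-]|u Au]; [rewrite /= fK|exists (f u); rewrite ?fK].
pose F : {mfun coin_space >-> coin_space} := HB.pack f
  (isMeasurableFun.Build _ _ _ _ (f : coin_space -> coin_space) tail_equivariant_measurable).
move=> mA; rewrite -[LHS]/(distribution mu F A).
apply: (@measure_unique _ R coin_space cylindrical (fun=> setT)) => //.
- exact: cylindrical_setI.
- by move=> _; exact: cylindrical_setT.
- by rewrite bigcup_const//; exists 0%N.
- move=> B [m Bm]; rewrite /distribution /pushforward.
  pose n := maxn M m.
  have Bn u z : (forall c, (c < n)%N -> z c = 0) -> B u -> B (u + z).
    by move=> zn; apply: Bm => c cm; apply: zn; rewrite leq_max cm orbT.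
  have fn u z : (forall c, (c < n)%N -> z c = 0) -> f (u + z) = f u + z.
    by move=> zn; apply: fM => c cm; apply: zn; rewrite leq_max cm.
  have head_pad u : exists2 z : bits, pad (head_bits n u) = u + z &
      forall c, (c < n)%N -> z c = 0.
    exists (pad (head_bits n u) - u); first by rewrite addrC subrK.
    move=> c cn; have := @head_bitsK n u c cn; rewrite addbitsE => ->; exact: subrr (u c).
  apply: (etrans _ (esym (coin_tossing_cylindrical Bn))).
  apply: (etrans (@coin_tossing_cylindrical (f @^-1` B) n _)).
    by move=> u z zn; rewrite /= fn//; exact: Bn.
  (* The permutation of the patterns of length [n] induced by [f]; padding changes only coordinates
     from [n] on, with which [f] commutes. *)
  pose h (w : {ffun 'I_n -> 'Z_2}) := head_bits n (f (pad w)).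
  have hK : involutive h.
    move=> w; rewrite /h; have [z -> z0] := head_pad (f (pad w)).
    rewrite fn// fK; apply/ffunP => i; rewrite ffunE addbitsE z0// addr0.
    exact: padE.
  rewrite [RHS](reindex_inj (inv_inj hK)) /=; apply: eq_bigl => w.
  apply: asbool_equiv_eq; rewrite /h; have [z -> z0] := head_pad (f (pad w)).
  split; first exact: Bn.
  rewrite -{2}[f (pad w)](addrK z); apply: Bn => c cn.
  by rewrite -[RHS]oppr0 -(z0 c cn).
- by move=> _; apply: (@le_lt_trans _ _ 1%E); rewrite ?ltry//; exact: probability_le1.
Qed.
End Invariance.

Definition unit_bit c : bits := fun c' => (c' == c)%:R.

Lemma addbits_preserving (R : realType) z A : measurable (A : set coin_space) ->
  coin_tossing R ((+%R^~ z) @` A) = coin_tossing R A.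
Proof.
apply: (@tail_equivariant_preserving R _ 0) => [u|u z' _].
  by rewrite -addrA addbits addr0.
by rewrite addrAC.
Qed.

Section Weights.
Variable R : realType.
Local Notation mu := (@coin_tossing R).

(** Flipping bit [c] preserves the measure and [A], and exchanges the two halves of [A]. *)
Lemma coin_tossing_bit A c (b : 'Z_2) :
  (forall u z, (forall c', (c' < c)%N -> z c' = 0) -> A u -> A (u + z)) ->
  (mu (A `&` [set u | u c = b]) = (2^-1)%:E * mu A)%E.
Proof.
move=> Ac; have mB b' : measurable (A `&` [set u | u c = b'] : set coin_space).
  apply: cylindrical_measurable; exists c.+1 => u z zc [Au uc]; split.
    by apply: Ac => // c' cc'; apply: zc; rewrite ltnW.
  by rewrite /= addbitsE zc// addr0.
have flip : mu (A `&` [set u | u c = b + 1]) = mu (A `&` [set u | u c = b]).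
  rewrite -(addbits_preserving R (unit_bit c) (mB b)); congr (mu _).
  apply/seteqP; split=> [u [Au uc]|_ [u [Au uc] <-]].
    exists (u + unit_bit c).
      split; first by apply: Ac => // c' c'c; rewrite /unit_bit ltn_eqF.
      by rewrite /= addbitsE uc /unit_bit eqxx -addrA addZ2K addr0.
    by rewrite -addrA addbits addr0.
  split; first by apply: Ac => // c' c'c; rewrite /unit_bit ltn_eqF.
  by rewrite /= addbitsE uc /unit_bit eqxx.
have -> : (mu A = mu (A `&` [set u | u c = b]) + mu (A `&` [set u | u c = (b + 1)%R]))%E.
  rewrite -measureU//.
    congr (mu _); rewrite -setIUr; apply/esym/setIidPl => u _ /=.
    have : forall x y : 'Z_2, x = y \/ x = y + 1.
      move=> x y; rewrite (Z2P x) (Z2P y).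
      by case: (x != 0); case: (y != 0); (left; apply: val_inj; done) || (right; apply: val_inj; done).
    exact.
  apply/seteqP; split=> // u [[_ /= ->] [_ /= /eqP]].
  by rewrite -subr_eq0 opprD addrA subrr add0r oppr_eq0 oner_eq0.
have xf : mu (A `&` [set u | u c = b]) \is a fin_num by exact: fin_num_measure.
by rewrite flip -(fineK xf) -EFinD -EFinM; congr EFin; field.
Qed.

Definition weight i j u : nat := (\sum_(i <= c < j) (u c != 0%R))%N.

Lemma weightD i j u z : (forall c, (c < j)%N -> z c = 0) ->
  weight i j (u + z) = weight i j u.
Proof.
by move=> z0; apply: eq_big_nat => c /andP[_ cj]; rewrite addbitsE z0// addr0.
Qed.

Lemma coin_tossing_weight i n k :
  mu [set u | weight i (i + n) u = k] = ('C(n, k)%:R / 2 ^+ n)%:E.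
Proof.
elim: n k => [|n IHn] k.
  rewrite addn0 expr0 divr1 (_ : [set _ | _] = [set u | 0%N = k]).
    case: k => [|k].
      by rewrite (_ : [set _ | _] = setT) ?probability_setT//; apply/seteqP; split.
    by rewrite (_ : [set _ | _] = set0) ?measure0//; apply/seteqP; split.
  by apply/seteqP; split=> u /=; rewrite /weight big_geq.
have mW k' (b : 'Z_2) : measurable
    ([set u | weight i (i + n) u = k'] `&` [set u | u (i + n)%N = b] : set coin_space).
  apply: cylindrical_measurable; exists (i + n).+1 => u z z0 [/= wu ub]; split => /=.
    by rewrite weightD// => c ci; apply: z0; rewrite ltnW.
  by rewrite addbitsE z0// addr0.
have half k' b : mu ([set u | weight i (i + n) u = k'] `&` [set u | u (i + n)%N = b]) =
    ('C(n, k')%:R / 2 ^+ n.+1)%:E.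
  rewrite coin_tossing_bit ?IHn; last by move=> u z z0 /= <-; rewrite weightD.
  by rewrite -EFinM exprS; congr EFin; field; rewrite expf_neq0.
have wS u : weight i (i + n.+1) u = (weight i (i + n) u + (u (i + n)%N != 0%R))%N.
  by rewrite addnS /weight big_nat_recr//= leq_addr.
case: k => [|k].
  rewrite (_ : [set _ | _] =
      [set u | weight i (i + n) u = 0%N] `&` [set u | u (i + n)%N = 0]) ?half ?bin0//.
  apply/seteqP; split=> u /=; rewrite wS; last by case=> -> ->; rewrite eqxx.
  by move=> /eqP; rewrite addn_eq0 eqb0 negbK => /andP[/eqP -> /eqP ->].
rewrite (_ : [set _ | _] =
    ([set u | weight i (i + n) u = k.+1] `&` [set u | u (i + n)%N = 0]) `|`
    ([set u | weight i (i + n) u = k] `&` [set u | u (i + n)%N = 1])).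
  rewrite measureU//; last by apply/seteqP; split=> // u [[_ /= ->] [_ /eqP]].
  apply: (etrans (congr2 adde (half _ _) (half _ _))).
  by rewrite binS natrD mulrDl EFinD.
apply/seteqP; split=> u /=; rewrite wS; last first.
  by case=> -[-> ->]; rewrite ?eqxx ?oner_eq0 ?addn0 ?addn1.
have [u0|u0] := eqVneq (u (i + n)%N) 0; first by rewrite addn0; left.
by rewrite addn1 => -[]; right; split=> //; rewrite (Z2P (u _)) u0.
Qed.
End Weights.

(** * Central binomial coefficients and nearly balanced blocks *)

Lemma bin_le_central m k : ('C(m.*2, k) <= 'C(m.*2, m))%N.
Proof.
have mono j : (j <= m)%N -> ('C(m.*2, j) <= 'C(m.*2, m))%N.
  move=> jm; rewrite -(subKn jm); elim: (m - j)%N (leq_subr j m) => [|d IHd] dm.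
    by rewrite subn0.
  apply: leq_trans (IHd (ltnW dm)).
  have e : (m - d)%N = (m - d.+1).+1 by lia.
  rewrite e -(@leq_pmul2l (m - d.+1).+1)// mul_bin_left.
  by rewrite leq_mul2r; apply/orP; right; lia.
have [km|mk] := leqP k m; first exact: mono.
have [k2|k2] := leqP k m.*2; last by rewrite bin_small.
by rewrite -bin_sub//; apply: mono; lia.
Qed.

Lemma bin_odd_le m k : ('C(m.*2.+1, k) <= 2 * 'C(m.*2, m))%N.
Proof.
rewrite mulSn mul1n; case: k => [|k]; last by rewrite binS leq_add ?bin_le_central.
by rewrite bin0; have := bin_le_central m 0; rewrite bin0; lia.
Qed.

(** The bound 4^m / sqrt(2m+1) in squared form, by induction from the ratio 2(2m+1)/(m+1) of
    consecutive central coefficients and (2m+1)(2m+3) <= (2m+2)^2. *)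
Lemma central_bin_sqr m : ('C(m.*2, m) ^ 2 * m.*2.+1 <= 16 ^ m)%N.
Proof.
elim: m => [//|m IHm].
have e1 := mul_bin_diag m.+1.*2 m; have e2 := mul_bin_diag m.*2.+1 m.
have e3 := @bin_sub m.*2.+1 m.
move: e1 e2 e3; rewrite !doubleS /=.
have -> : (m.*2.+1 - m)%N = m.+1 by lia.
set c := 'C(m.*2, m) in IHm *; set c1 := 'C(m.*2.+1, m); set c2 := 'C(m.*2.+1, m.+1).
set c' := 'C(m.*2.+2, m.+1) => e1 e2 e3.
have {}e3 : c2 = c1 by apply: e3; lia.
have e4 : (m.+1 * c' = 2 * m.*2.+1 * c)%N by nia.
rewrite -(@leq_pmul2l (m.+1 ^ 2)) ?expn_gt0// mulnA -expnMn e4.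
have -> : ((2 * m.*2.+1 * c) ^ 2 * m.*2.+3 = c ^ 2 * m.*2.+1 * (4 * m.*2.+1 * m.*2.+3))%N.
  by rewrite !expnS !expn0; ring.
apply: (leq_trans (leq_mul IHm (leqnn _))).
have : (4 * m.*2.+1 * m.*2.+3 <= m.+1 ^ 2 * 16)%N by rewrite !expnS expn0; nia.
by move=> h; rewrite [(16 ^ m.+1)%N]expnS [X in (_ <= X)%N]mulnA [X in (_ <= X)%N]mulnC leq_mul2l h orbT.
Qed.

Section Middle.
Variable R : realType.
Local Notation mu := (@coin_tossing R).

Definition middle i m l : set bits :=
  [set u | (m <= weight i (i + m.*2.+1) u + l)%N &&
           (weight i (i + m.*2.+1) u <= m.+1 + l)%N].

Lemma middle_cylindrical i m l : cylindrical (middle i m l).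
Proof. by exists (i + m.*2.+1)%N => u z z0; rewrite /middle /= weightD. Qed.

Let window_measure i n s N (B : R) :
  (forall k, 'C(n, k)%:R / 2 ^+ n <= B) ->
  (mu [set u | (s <= weight i (i + n) u < s + N)%N] <= (N%:R * B)%:E)%E.
Proof.
move=> CB; have mW (P : pred nat) : measurable ([set u | P (weight i (i + n) u)] : set coin_space).
  by apply: cylindrical_measurable; exists (i + n)%N => u z z0; rewrite /= weightD.
elim: N => [|N IHN].
  rewrite mul0r (_ : [set _ | _] = set0) ?measure0//.
  by apply/seteqP; split=> // u /=; rewrite addn0 => /andP[/leq_ltn_trans h /h]; rewrite ltnn.
rewrite (_ : [set _ | _] = [set u | (s <= weight i (i + n) u < s + N)%N] `|`
    [set u | weight i (i + n) u == (s + N)%N]); last first.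
  apply/seteqP; split=> u /=; rewrite addnS ltnS.
    rewrite [(weight _ _ _ <= _)%N]leq_eqVlt => /andP[-> /orP[->|->]]; by [right|left].
  move=> [/andP[-> /ltnW->//]|/eqP ->]; by rewrite leq_addr leqnn.
apply: (le_trans (measureU2 _ (mW (fun k => s <= k < s + N)%N) (mW (pred1 (s + N)%N)))).
rewrite -natr1 mulrDl mul1r EFinD; apply: leeD; first exact: IHN.
rewrite [X in (mu X <= _)%E](_ : _ = [set u | weight i (i + n) u = (s + N)%N]).
  by rewrite coin_tossing_weight lee_fin.
by apply/seteqP; split=> u /eqP.
Qed.

(** The window contains [2 * l + 2] weights, each of probability of order at most m^(-1/2), whatever
    the position of the block. *)
Lemma middle_small (l : nat) (d : R) : 0 < d ->
  exists2 m, (l <= m)%N & forall i, (mu (middle i m l) <= d%:E)%E.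
Proof.
move=> d0; pose N := l.*2.+2.
(* Since [B ^+ 2 * (2m+1) <= 1], taking [m] at least the integer part of [(N / d) ^+ 2] gives
   [N * B <= d]; and [l <= m] keeps [m - l] an honest difference. *)
pose m := maxn l (Num.truncn ((N%:R / d) ^+ 2)).
exists m => [|i]; first by rewrite leq_maxl.
pose B : R := 'C(m.*2, m)%:R / 4 ^+ m.
have B0 : 0 <= B by rewrite divr_ge0 ?exprn_ge0.
have CB k : 'C(m.*2.+1, k)%:R / 2 ^+ m.*2.+1 <= B.
  rewrite ler_pdivrMr ?exprn_gt0// /B exprS -mul2n exprM (_ : 2 ^+ 2 = 4 :> R); last by ring.
  rewrite mulrCA -mulrA mulVf ?expf_neq0// mulr1 mul2n -natrM ler_nat.
  exact: bin_odd_le.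
have NB : N%:R * B <= d.
  have Bm : B ^+ 2 * m.*2.+1%:R <= 1.
    rewrite /B expr_div_n mulrAC ler_pdivrMr ?exprn_gt0 ?exprn_gt0// mul1r.
    have := central_bin_sqr m; rewrite -(ler_nat R) natrM !natrX -exprM mulnC exprM.
    by rewrite (_ : 4 ^+ 2 = 16 :> R)//; ring.
  have Nd : (N%:R / d) ^+ 2 <= m.*2.+1%:R :> R.
    apply: ltW; apply: (lt_le_trans (truncnS_gt _)); rewrite ler_nat ltnS.
    by rewrite -addnn; apply: leq_trans (leq_addr _ _); rewrite leq_maxr.
  have : (N%:R / d) * B <= 1.
    have NB0 : 0 <= N%:R / d * B by rewrite mulr_ge0 ?divr_ge0// ltW.
    rewrite -(@ler_pXn2r _ 2) ?nnegrE// expr1n exprMn.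
    by apply: le_trans Bm; rewrite mulrC ler_wpM2l// exprn_ge0.
  by rewrite mulrAC ler_pdivrMr// mul1r.
apply: (@le_trans _ _ (N%:R * B)%:E); last by rewrite lee_fin.
apply: le_trans (window_measure i (m - l) N CB).
rewrite le_measure// ?inE.
- by apply: cylindrical_measurable; exact: middle_cylindrical.
- by apply: cylindrical_measurable; exists (i + m.*2.+1)%N => u z z0; rewrite /= weightD.
- have lm : (l <= m)%N by rewrite leq_maxl.
  by move=> u; rewrite /middle/= /N => /andP[h1 h2]; apply/andP; split; lia.
Qed.
End Middle.

(** * The skew-product action *)

Definition slice i j u : bits := fun c => if (i <= c < j)%N then u c else 0.

Lemma sliceD i j u v : slice i j (u + v) = slice i j u + slice i j v.
Proof.
by apply/funext => c; rewrite addbitsE /slice; case: ifP; rewrite ?addr0.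
Qed.

Lemma slice0 i j u : (forall c, (i <= c < j)%N -> u c = 0) -> slice i j u = 0.
Proof. by move=> u0; apply/funext => c; rewrite /slice; case: ifP => // /u0. Qed.

Lemma eq_slice i j u v : (forall c, (i <= c < j)%N -> u c = v c) -> slice i j u = slice i j v.
Proof. by move=> uv; apply/funext => c; rewrite /slice; case: ifP => // /uv. Qed.

Section SkewAction.
Implicit Types g : bits.
Variables (a : nat -> nat) (high : nat -> bits -> bool) (k : nat -> bits).
Hypotheses (aS : forall N, (a N <= a N.+1)%N)
  (highE : forall N u v, (forall c, (a N <= c < a N.+1)%N -> u c = v c) ->
     high N u = high N v).

(** Blocks are treated from the top down; the change of majority in block [N'] decides whether
    [k N'] is added to the element passed to the lower levels. *)
Fixpoint skew N g u : bits :=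
  if N is N'.+1 then
    let v := u + slice (a N') (a N'.+1) g in
    skew N' (g + k N' *+ (high N' v != high N' u)) v
  else u + slice 0 (a 0) g.

Lemma skew_tail N g u z : (forall c, (c < a N)%N -> z c = 0) ->
  skew N g (u + z) = skew N g u + z.
Proof.
elim: N g u => [|N IHN] g u z0 /=; first by rewrite addrAC.
have z0' c : (c < a N)%N -> z c = 0 by move=> cN; apply: z0; exact: leq_trans (aS N).
have hz w : high N (w + z) = high N w.
  by apply: highE => c /andP[_ cN]; rewrite addbitsE z0// addr0.
by rewrite addrAC !hz IHN.
Qed.

Lemma skew_ge N g u c : (a N <= c)%N -> skew N g u c = u c.
Proof.
elim: N g u => [|N IHN] g u /= Nc.
  by rewrite addbitsE /slice leq0n ltnNge Nc addr0.
rewrite IHN; last exact: leq_trans (aS N) Nc.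
by rewrite addbitsE /slice [(c < _)%N]ltnNge Nc andbF addr0.
Qed.

(** The change of majority is a coboundary: over two successive moves the intermediate value cancels
    modulo 2. The lower levels neither alter block [N] nor depend on it. *)
Lemma skewD N g g' u : skew N (g + g') u = skew N g (skew N g' u).
Proof.
elim: N g g' u => [|N IHN] g g' u /=; first by rewrite sliceD addrA [LHS]addrAC.
set r := slice _ _ _; set r' := slice _ _ g'; set rg := slice _ _ g.
have -> : r = r' + rg by rewrite /r sliceD addrC.
set b1 := high N (u + r') != high N u; set w := skew N _ (u + r').
have -> : w + rg = skew N (g' + k N *+ b1) (u + r' + rg).
  by rewrite skew_tail// => c cN; rewrite /rg /slice leqNgt cN.
have hw v : high N (skew N (g' + k N *+ b1) v) = high N v.
  by apply: highE => c /andP[Nc _]; rewrite skew_ge.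
rewrite hw /w hw -IHN addrA; congr skew.
rewrite addrACA -!addrA; congr (g + (g' + _)).
rewrite /b1; case: (high N _); case: (high N _); case: (high N _) => //=;
  by rewrite ?addr0 ?add0r ?addbits.
Qed.

Lemma skew_zero N u : skew N 0 u = u.
Proof.
elim: N u => [|N IHN] u /=; first by rewrite slice0// addr0.
by rewrite slice0// addr0 eqxx addr0.
Qed.

Lemma eq_skew N g g' u : (forall c, (c < a N)%N -> g c = g' c) -> skew N g u = skew N g' u.
Proof.
elim: N g g' u => [|N IHN] g g' u gg' /=; first by rewrite (eq_slice (v := g')).
have -> : slice (a N) (a N.+1) g = slice (a N) (a N.+1) g'.
  by apply: eq_slice => c /andP[_ /gg'].
by apply: IHN => c cN; rewrite !addbitsE gg'//; exact: leq_trans (aS N).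
Qed.

Let a_mono M N : (M <= N)%N -> (a M <= a N)%N.
Proof. by apply: (@homo_leq _ _ leq) => // x y z; exact: leq_trans. Qed.

(** A block where [g] vanishes is not moved and triggers no correction, so any depth beyond the
    support gives the same map. *)
Lemma skew_stable M N g u : (M <= N)%N -> (forall c, (a M <= c)%N -> g c = 0) ->
  skew N g u = skew M g u.
Proof.
move=> + g0; elim: N => [|N IHN]; first by rewrite leqn0 => /eqP ->.
rewrite leq_eqVlt => /orP[/eqP -> //|]; rewrite ltnS => MN /=.
rewrite slice0; first by rewrite addr0 eqxx addr0 IHN.
by move=> c /andP[Nc _]; apply: g0; exact: leq_trans (a_mono MN) Nc.
Qed.

Lemma skew_base N g u : (forall c, (a 0 <= c)%N -> g c = 0) -> skew N g u = u + g.
Proof.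
move=> g0; rewrite (@skew_stable 0)//=; congr (u + _); apply/funext => c.
by rewrite /slice leq0n /=; case: ltnP => // /g0.
Qed.

(** Levels above [i] are idle; the correction at level [i] leaves [unit_bit 0] below the block,
    which lies in the base part and so acts by plain translation. *)
Lemma skew_flip N g u i : (i < N)%N ->
  (forall c, (a i.+1 <= c)%N -> g c = 0) ->
  (forall c, (c < a i)%N -> g c + k i c = unit_bit 0 c) ->
  (0 < a 0)%N ->
  high i (u + slice (a i) (a i.+1) g) != high i u ->
  skew N g u = u + slice (a i) (a i.+1) g + unit_bit 0.
Proof.
move=> iN g0 gk a0 flip; rewrite (@skew_stable i.+1)//= flip /=.
rewrite (@eq_skew _ _ (unit_bit 0)) ?skew_base// => c c0.
by rewrite /unit_bit; case: c c0 => //; rewrite leqNgt a0.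
Qed.

Lemma skew_equivariant N g :
  involutive (skew N g) /\
  forall u z, (forall c, (c < a N)%N -> z c = 0) -> skew N g (u + z) = skew N g u + z.
Proof.
by split=> [u|u z]; [rewrite -skewD addbits skew_zero|exact: skew_tail].
Qed.
End SkewAction.

(* Adding a vector with at most l zeros on the block turns weight w into n - w
   up to l. *)
Lemma high_flip i m l u (g : bits) :
  (\sum_(i <= c < i + m.*2.+1) (g c == 0%R) <= l)%N -> ~ middle i m l u ->
  (m < weight i (i + m.*2.+1) (u + slice i (i + m.*2.+1) g)%R)%N !=
  (m < weight i (i + m.*2.+1) u)%N.
Proof.
set j := (i + _)%N => gl; rewrite /middle /= -/j => mid.
set v := u + _.
have sum1 : (\sum_(i <= c < j) 1 = m.*2.+1)%N.
  by rewrite sum_nat_const_nat muln1 /j addKn.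
have vE c : (i <= c < j)%N -> v c = u c + g c by move=> ic; rewrite /v addbitsE /slice ic.
have lo : (m.*2.+1 <= weight i j u + weight i j v + l)%N.
  apply: leq_trans (leq_add (leqnn _) gl); rewrite -sum1 /weight -!big_split /=.
  rewrite big_nat [X in (_ <= X)%N]big_nat; apply: leq_sum => c /vE ->.
  by rewrite (Z2P (u c)) (Z2P (g c)); case: (u c != 0); case: (g c != 0).
have hi : (weight i j u + weight i j v <= m.*2.+1 + l)%N.
  apply: leq_trans (leq_add (leqnn _) gl); rewrite -sum1 /weight -!big_split /=.
  rewrite big_nat [X in (_ <= X)%N]big_nat; apply: leq_sum => c /vE ->.
  by rewrite (Z2P (u c)) (Z2P (g c)); case: (u c != 0); case: (g c != 0).
move: mid lo hi; move: (weight i j u) (weight i j v) => p q mid lo hi.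
by apply/eqP; lia.
Qed.

(** * Recurrence *)

(* If finitely many translates of U cover the space, colouring g by a translate
   that contains T g x turns a monochromatic pair into a return time of U. *)
Lemma chromatic_topological_recurrence (R : realType) (G : zmodType) (S : set G) :
  (forall (r : nat) (c : G -> nat), (forall g, c g < r)%N ->
     exists g g', c g = c g' /\ S (g - g')) ->
  topological_recurrence R S.
Proof.
move=> HS X T [[[x0 _] cX [T0 TD] hT] dT] U oU U0.
pose pX : ptopologicalType := HB.pack_for ptopologicalType X (isPointed.Build X x0).
have : @cover_compact X [set: X] by rewrite -(@compact_cover pX).
move=> /(_ G setT (fun g => T g @^-1` U)) [].
- by move=> g _; have [f' [_ _ /continuousP + _]] := hT g; exact.
- move=> x _; have [y [Uy [g _ gx]]] := dT x U U0 oU.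
  by exists g => //=; rewrite gx.
move=> F _ FU.
have [s sF] : exists s : seq G, forall x, has (fun g => `[< U (T g x) >]) s.
  exists (finmap.enum_fset F) => x; have [g gF Ug] := FU x I.
  by apply/hasP; exists g => //; apply/asboolP.
pose c y := find (fun g => `[< U (T (g + y) x0) >]) s.
have cs y : has (fun g => `[< U (T (g + y) x0) >]) s.
  by have := sF (T y x0); apply: sub_has => g; rewrite TD.
have [|y [y' [cyy' Sy]]] := HS (size s) c.
  by move=> y; rewrite -has_find.
have := nth_find 0 (cs y); have := nth_find 0 (cs y').
rewrite -/(c y) -/(c y') cyy'; set g := nth _ _ _ => /asboolP Uy' /asboolP Uy.
exists (y - y') => //; exists (T (g + y) x0); split=> //.
exists (T (g + y') x0) => //; rewrite -TD; congr T.
by rewrite addrCA subrK.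
Qed.

Lemma G2addE (g h : G2) c : (g + h) c = g c + h c. Proof. by []. Qed.
Lemma G2oppE (g : G2) c : (- g) c = - g c. Proof. by []. Qed.

Lemma G2_support (g : G2) : exists s : seq nat, forall c, g c = (c \in s)%:R.
Proof.
have /asboolP/finite_seqP[s gs] := G2valP g.
exists s => c; rewrite [LHS]Z2P; congr (_%:R); congr nat_of_bool.
have e : is_true (g c != 0) = is_true (c \in s) := congr1 (fun A : set nat => A c) gs.
by apply/idP/idP => ?; rewrite ?e// -e.
Qed.

Section BlockVectors.
Variables (a n : nat).

Definition block_bits (x : {ffun 'I_n -> bool}) : nat -> 'Z_2 :=
  fun c => if (a <= c)%N then (if insub (c - a)%N is Some i then (x i)%:R else 0) else 0.

Lemma block_bits_finsupp x : block_bits x \in finsupp2.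
Proof.
rewrite inE; apply: (@sub_finite_set _ _ (`I_(a + n))); last exact: finite_II.
move=> c; apply: contra_neqT; rewrite /block_bits; case: (leqP a c) => // ac.
by case: insubP => // i can _ /=; lia.
Qed.

Definition block_vector x : G2 := MkG2 (block_bits_finsupp x).

Lemma block_vectorE x (i : 'I_n) : block_vector x (i + a)%N = (x i)%:R.
Proof. by rewrite /block_vector /= /block_bits leq_addl addnK valK. Qed.

Lemma block_vector_out x c : ~~ (a <= c < a + n)%N -> block_vector x c = 0.
Proof.
rewrite /block_vector /= /block_bits; case: (leqP a c) => //= ac.
by case: insubP => // i; rewrite -ltn_subLR// => ->.
Qed.
End BlockVectors.

Theorem theorem1p4 (R : realType) (eps : R) (eps_gt0 : 0 < eps) :
  exists (d : measure_display) (X : measurableType d) (mu : probability X R)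
         (T : G2 -> X -> X) (D : set X) (S : set G2),
    [/\ measure_preserving_action mu T,
        measurable D,
        ((2^-1 - eps)%:E < mu D)%E,
        forall h : G2, topological_recurrence R (translate S h)
      & forall g : G2, S g -> D `&` (T g @` D) = set0].
Proof.
(* Block [i] serves the pair (support of h, number of colours) coded by [i]; indices coding nothing
   get the harmless default of empty support and no colours. *)
pose code i : seq nat * nat := odflt ([::], 0%N) (unpickle i).
pose top (s : seq nat) : nat := (\max_(c <- s) c)%N.
have topP s c : c \in s -> (c <= top s)%N by move=> cs; exact: leq_bigmax_seq.
(* The first bound leaves room for [r] zeros. The second, with [l i <= m i], makes block [i] long
   enough for the support of the next h to lie below block [i.+1]. *)
pose l i := maxn (code i).2 (top (code i.+1).1).
pose e2 : R := eps / 2.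
have e20 : 0 < e2 by rewrite divr_gt0.
have small i : exists m, (l i <= m)%N /\
    forall j, (coin_tossing R (middle j m (l i)) <= (e2 / (2 ^ i.+1)%:R)%:E)%E.
  have [|m lm mP] := @middle_small R (l i) (e2 / (2 ^ i.+1)%:R); last by exists m.
  by rewrite divr_gt0// ltr0n expn_gt0.
have [m mP] := choice small.
(* The successor puts the support of [h 0] strictly below [a 0] and coordinate 0 into the base
   part. *)
pose a := fix a i : nat := if i is i'.+1 then (a i' + (m i').*2.+1)%N else (top (code 0).1).+1.
pose h i : bits := fun c => (c \in (code i).1)%:R.
pose high i (u : bits) := (m i < weight (a i) (a i.+1) u)%N.
pose k i : bits := h i + unit_bit 0.
have a0 : (0 < a 0)%N by [].
have aS i : (a i <= a i.+1)%N by rewrite leq_addr.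
have a_gt i : (i < a i)%N by elim: i => //= i IHi; lia.
have a_mono i j : (i <= j)%N -> (a i <= a j)%N.
  by apply: (@homo_leq _ _ leq) => // x y z; exact: leq_trans.
have h_lt i c : (a i <= c)%N -> h i c = 0.
  move=> ac; rewrite /h; case: (boolP (_ \in _)) => // /topP ct; exfalso.
  case: i => [|i] in ac ct *; first by move: ac; rewrite /= ltnNge ct.
  have [lm _] := mP i; have : (top (code i.+1).1 <= l i)%N by rewrite leq_maxr.
  by move: ac => /=; lia.
have highE i (u v : bits) : (forall c, (a i <= c < a i.+1)%N -> u c = v c) -> high i u = high i v.
  by move=> uv; rewrite /high /weight; congr (_ < _)%N; apply: eq_big_nat => c /uv ->.
have supp_bound (g : G2) : exists N, forall c, (a N <= c)%N -> g c = 0.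
  have [s gs] := G2_support g; exists (top s) => c ac; rewrite gs.
  by case: (boolP (_ \in _)) => // /topP; rewrite leqNgt (leq_trans (a_gt _) ac).
have [b bP] := choice supp_bound.
(* [b g] is some depth beyond the support of [g]; by [skew_stable] a common depth can be used for
   several elements. *)
pose T (g : G2) : coin_space -> coin_space := skew a high k (b g) (g : nat -> 'Z_2).
have TE (g : G2) N (u : bits) : (b g <= N)%N -> T g u = skew a high k N (g : nat -> 'Z_2) u.
  by move=> gN; rewrite /T (@skew_stable a high k aS _ _ _ u gN)//; exact: bP.
have T_action : is_action T.
  split=> [x|g g' x]; first exact: skew_zero.
  pose N := maxn (b (g + g')) (maxn (b g) (b g')).
  rewrite !(TE _ N) ?leq_max ?leqnn ?orbT// -skewD//.
have Tpres (g : G2) : involutive (T g) /\ forall u z : bits,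
    (forall c, (c < a (b g))%N -> z c = 0) -> T g (u + z) = T g u + z.
  exact: skew_equivariant.
pose mid := \bigcup_i middle (a i) (m i) (l i).
pose Z : set bits := [set u : bits | u 0%N = 0].
pose D : set bits := Z `\` mid.
pose S : set G2 := [set g | exists i, [/\ forall c, (c < a i)%N -> g c = h i c,
  forall c, (a i.+1 <= c)%N -> g c = 0
  & (\sum_(a i <= c < a i.+1) (g c == 0%R) <= l i)%N]].
have m0 : measurable (Z : set coin_space).
  apply: cylindrical_measurable; exists 1%N => u z z0 u0.
  by rewrite /Z /= addbitsE z0// addr0; exact: u0.
have mmid i : measurable (middle (a i) (m i) (l i) : set coin_space).
  by apply: cylindrical_measurable; exact: middle_cylindrical.
have mbig : measurable (mid : set coin_space) by exact: bigcup_measurable.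
have mD : measurable (D : set coin_space) by exact: measurableD.
exists _, coin_space, (coin_tossing R), T, D, S; split=> //.
- split=> // [g|g A mA]; have [gK gM] := Tpres g.
    exact: (tail_equivariant_measurable gM).
  exact: (tail_equivariant_preserving R gK gM).
(* The exceptional sets have total mass at most [eps / 2], and the spare half of [eps] makes the
   final inequality strict. *)
- have mid_le : (coin_tossing R mid <= e2%:E)%E.
    apply: (@le_trans _ _ (\sum_(i <oo) coin_tossing R (middle (a i) (m i) (l i)))%E).
      exact: measure_sigma_subadditive.
    apply: (@le_trans _ _ (\sum_(i <oo) (e2 / (2 ^ i.+1)%:R)%:E)%E).
      by apply: lee_nneseries => // i _; have [_] := mP i; apply.
    exact: epsilon_trick0 (ltW e20).
  have half : coin_tossing R Z = (2^-1)%:E.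
    rewrite -[Z]setTI coin_tossing_bit//.
    by rewrite probability_setT mule1.
  have : ((2^-1)%:E <= coin_tossing R D + coin_tossing R mid)%E.
    rewrite -half; apply: le_trans (measureU2 _ mD mbig).
    rewrite le_measure ?inE//; first exact: measurableU.
    by move=> u u0; have [um|um] := pselect (mid u); [right|left].
  have Df : coin_tossing R D \is a fin_num by exact: fin_num_measure.
  have midf : coin_tossing R mid \is a fin_num by exact: fin_num_measure.
  move: mid_le; rewrite -(fineK Df) -(fineK midf) -EFinD !lee_fin lte_fin /e2.
  by move=> h1 h2; lra.
- move=> hh; apply: chromatic_topological_recurrence => r c cr.
  (* The block reserved for the shift [hh] and [r] colours: [c] is restricted to vectors supported
     in it. *)
  have [s hs] := G2_support hh; pose i := pickle (s, r).
  have ci : code i = (s, r) by rewrite /code /i pickleK.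
  have rl : (r <= l i)%N by rewrite /l ci leq_maxl.
  have [lm _] := mP i.
  pose n := (m i).*2.+1; pose blk := @block_vector (a i) n.
  have rn : (r <= n)%N by rewrite /n; lia.
  have hhE c' : hh c' = h i c' by rewrite hs /h ci.
  have [x [y [cxy dxy]]] := near_antipodal_pair rn (fun x => cr (blk x)).
  exists (blk x), (blk y); split=> //.
  (* Below the block this is [- hh = h i]; on the block its zeros are the positions where [x] and
     [y] agree, at most [r] of them. *)
  exists (blk x - blk y - hh); last by rewrite subrK.
  exists i; split=> [c' ca|c' ac|].
  + rewrite !G2addE !G2oppE !block_vector_out ?[(a i <= c')%N]leqNgt ?ca//.
    by rewrite subr0 add0r hhE; apply/eqP; rewrite eq_sym -addr_eq0 addZ2K.
  + rewrite !G2addE !G2oppE !block_vector_out ?[(c' < _)%N]ltnNge ?ac ?andbF//.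
    by rewrite hhE h_lt ?subrr//; exact: leq_trans ac.
  + rewrite -{1}[a i]add0n /= big_addn addKn big_mkord.
    have -> : (\sum_(j < n) ((blk x - blk y - hh : G2)%R (j + a i)%N == 0%R) =
        \sum_(j < n) (x j == y j))%N.
      apply: eq_bigr => j _; rewrite !G2addE !G2oppE !block_vectorE hhE h_lt ?leq_addl//.
      by case: (x j); case: (y j).
    have dE : (#|[set j | x j != y j]%SET| = \sum_(j < n) (x j != y j))%N.
      rewrite -sum1_card big_mkcond; apply: eq_bigr => j _.
      by rewrite inE; case: (x j == y j).
    have nE : (\sum_(j < n) (x j != y j) + \sum_(j < n) (x j == y j) = n)%N.
      rewrite -big_split -[RHS]card_ord -sum1_card.
      by apply: eq_bigr => j _; case: (x j == y j).
    by move: dxy; rewrite dE -{1}nE leq_add2l => /leq_trans; apply.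
- move=> g [i [g1 g2 g3]]; apply/seteqP; split=> // u [[/= u0 _] [v [/= v0 vmid] vu]].
  have flip := high_flip g3 (fun vm => vmid (ex_intro2 _ _ i I vm)).
  (* Below block [i], [g] equals [h i], which cancels in [k i] and leaves [unit_bit 0]; hence
     coordinate 0 of [u] would be 1, contradicting [u0]. *)
  have H : T g v = v + slice (a i) (a i.+1) (g : nat -> 'Z_2) + unit_bit 0.
    rewrite (TE g (maxn (b g) i.+1)) ?leq_maxl//.
    apply: (skew_flip aS) => //; first by rewrite leq_maxr.
    by move=> c ca; rewrite g1// /k addbitsE addrA addZ2K add0r.
  have {}v0 : v 0%N = 0 := v0; have : u 0%N = 0 := u0.
  rewrite -vu H !addbitsE v0 add0r /slice leqNgt (leq_trans a0 (a_mono _ _ (leq0n i))) /=.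
  by rewrite add0r /unit_bit.
Qed.
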